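(* Let $\bar t\in(0,\tfrac12)$, let $\varepsilon\in(0,\bar t)$, let $R:[0,\bar t]\to\mathbb{R}_{\ge 0}$ be non-decreasing, and let $F\in\mathcal{H}_{\bar t,R}$. Let the pairs $(Y_i,D_i)$, for $i\in[n]$, be drawn independently (across $i$) with marginals $Y_i\sim F$ and $D_i\sim\mathrm{Ber}(\varepsilon)$ ($Y_i$ and $D_i$ need not be independent of each other). Let $\{Z_i\}_{i\in[n]}$ be arbitrary random variables possibly depending on $\{Y_i,D_i\}_{i\in[n]}$, and define $X_i=(1-D_i)Y_i+D_iZ_i$. Then, for any confidence level $\delta\in(0,1)$ and any number of samples $n\ge 2(\bar t-\varepsilon)^{-2}\log\tfrac{3}{\delta}$, $$\mathbb{P}\left(\sup_{m\in m_1(F)}\left|\hat m_1(X_1,\dots,X_n)-m\right|\le R\left(\varepsilon+\sqrt{\frac{2\log(3/\delta)}{n}}\right)\right)\ge 1-\delta .$$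
   Context: Distributions are on $\mathbb{R}$ and identified with their cdfs; $[n]=\{1,\dots,n\}$. For a cdf $F$, the left and right quantiles are $Q_{L,F}(p)=\inf\{x\in\mathbb{R}:F(x)\ge p\}$ and $Q_{R,F}(p)=\inf\{x\in\mathbb{R}:F(x)>p\}$. The set of medians of $F$ is $m_1(F)=[Q_{L,F}(\tfrac12),Q_{R,F}(\tfrac12)]$. The empirical median $\hat m_1(x_1,\dots,x_n)$ is the middle value if $n$ is odd and the average of the two middle values if $n$ is even. For $\bar t\in(0,\tfrac12)$ and a non-decreasing function $R:[0,\bar t]\to\mathbb{R}_{\ge0}$, $\mathcal{H}_{\bar t,R}$ is the family of all distributions $F$ satisfying $$R(t)\ge\max\left\{Q_{R,F}\left(\tfrac12+t\right)-m,\; m-Q_{L,F}\left(\tfrac12-t\right)\right\}$$ for every $t\in[0,\bar t]$ and every median $m\in m_1(F)$. *)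

(* Defs.v *)
From HB Require Import structures.
From mathcomp Require Import all_boot all_order all_algebra.
From mathcomp Require Import all_classical all_reals all_analysis.

Set Implicit Arguments.
Unset Strict Implicit.
Unset Printing Implicit Defensive.

Import Order.TTheory GRing.Theory Num.Theory.
Import numFieldNormedType.Exports.

Local Open Scope classical_set_scope.
Local Open Scope ring_scope.

Definition law_cdf (R : realType) (F : probability R R)
  (x : R) : \bar R := F `]-oo, x]%classic.

(* The infima below are taken in [R]: they are genuine for levels p in ]0, 1[,
   the only ones at which these quantiles are used. *)
Definition quantileL (R : realType) (F : probability R R)
  (p : R) : R := inf [set x : R | (p%:E <= law_cdf F x)%E].

Definition quantileR (R : realType) (F : probability R R)
  (p : R) : R := inf [set x : R | (p%:E < law_cdf F x)%E].

Definition medians (R : realType) (F : probability R R) :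
    set R :=
  `[quantileL F 2^-1, quantileR F 2^-1].

(* [r : R -> R] stands for a function on [0, tbar]; only its values there are
   constrained or used. *)
Definition quantile_family (R : realType) (tbar : R) (r : R -> R) :
    set (probability R R) :=
  [set F | forall t, t \in `[0, tbar] -> forall m, medians F m ->
    Num.max (quantileR F (2^-1 + t) - m) (m - quantileL F (2^-1 - t)) <= r t].

(* For n even, the two middle values have 0-based ranks n/2 - 1 and n/2 *)
Definition empirical_median (R : realType) (n : nat) (x : 'I_n -> R) : R :=
  let s := sort <=%R [seq x i | i <- enum 'I_n] in
  if odd n then s`_n./2 else (s`_n./2.-1 + s`_n./2) / 2.

Definition mutually_independent (d d' : measure_display)
    (T : measurableType d) (T' : measurableType d') (R : realType)
    (P : probability T R) (I : finType) (W : I -> T -> T') : Prop :=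
  forall (J : {set I}) (A : I -> set T'), (forall i, measurable (A i)) ->
    P (\bigcap_(i in [set` J]) (W i @^-1` A i)) =
    (\prod_(i in J) P (W i @^-1` A i))%E.

(* Main.v *)
(* Fix t = eps + s with s ^ 2 = 2 ln (3 / delta) / n, and let A be either the
   half-line above quantileR (1/2 + t) or the one below quantileL (1/2 - t);
   F gives it mass at most 1/2 - t.  Since X i differs from Y i only when D i
   holds, X i \in A forces the event "Y i \in A or D i", whose probability is at
   most 1/2 - s, and these events are independent.  By Chernoff's bound at least
   half of them hold with probability at most exp (- 2 n s ^ 2); otherwise the
   empirical median is not in A.  No moments are needed: by independence the
   probability of a pattern J of occurring events is an explicit product, and
   the exponential tilting is done in the finite sum over J. *)
Require Import Defs.
From HB Require Import structures.
From mathcomp Require Import all_boot all_order all_algebra.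
From mathcomp Require Import all_classical all_reals all_analysis.
From mathcomp Require Import measurable_realfun.
From mathcomp Require Import ring lra zify.

Set Implicit Arguments.
Unset Strict Implicit.
Unset Printing Implicit Defensive.

Import Order.TTheory GRing.Theory Num.Theory.
Import numFieldNormedType.Exports.

Local Open Scope classical_set_scope.
Local Open Scope ring_scope.

(** * Chernoff bound for the majority of a pattern, as a finite inequality *)

Lemma tilted_mean_le (R : realType) (s p u : R) :
  0 <= s < 2^-1 -> p <= 2^-1 - s ->
  u = Num.sqrt ((2^-1 + s) / (2^-1 - s)) ->
  p * u + (1 - p) / u <= expR (- (2 * s ^+ 2)).
Proof.
move=> /andP[s0 s1] ps uE.
(* Since [u] >= 1 / [u], the left side increases with [p], so the worst case is [p] = 1/2 - s. There
   this [u] is the minimiser, with minimum sqrt (1 - 4 s^2); after squaring, 1 - 4 s^2 <= exp (- 4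
   s^2) remains. *)
have a0 : 0 < 2^-1 - s by lra.
have u0 : 0 < u by rewrite uE sqrtr_gt0 divr_gt0//; lra.
have u2 : u ^+ 2 = (2^-1 + s) / (2^-1 - s).
  by rewrite uE sqr_sqrtr// divr_ge0//; lra.
have u1 : 1 <= u.
  rewrite -(@ler_pXn2r _ 2)// ?nnegrE ?(ltW u0)// u2 expr1n.
  by rewrite ler_pdivlMr//; lra.
have un0 : u != 0 by rewrite gt_eqF.
have an0 : 2^-1 - s != 0 by rewrite gt_eqF.
have V1 : u^-1 <= u by rewrite (le_trans _ u1)// invf_le1.
have -> : p * u + (1 - p) / u = u^-1 + p * (u - u^-1) by ring.
have h : u^-1 + p * (u - u^-1) <= u^-1 + (2^-1 - s) * (u - u^-1).
  by rewrite lerD2l ler_wpM2r// subr_ge0.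
apply: le_trans h _.
have -> : u^-1 + (2^-1 - s) * (u - u^-1) = 2 * (2^-1 - s) * u.
  have -> : u^-1 + (2^-1 - s) * (u - u^-1) =
    (2^-1 - s) * u + (2^-1 + s) / u by field.
  have -> : 2^-1 + s = u ^+ 2 * (2^-1 - s) by rewrite u2 divfK.
  by field.
rewrite -(@ler_pXn2r _ 2)// ?nnegrE ?expR_ge0//; last first.
  by rewrite !mulr_ge0// ltW.
rewrite exprMn u2 -expRM_natr.
apply: le_trans (expR_ge1Dx _).
have -> : (2 * (2^-1 - s)) ^+ 2 * ((2^-1 + s) / (2^-1 - s)) =
    4 * ((2^-1 - s) * (2^-1 + s)).
  by move: (2^-1 - s) (2^-1 + s) an0 => a b a0'; field.
by rewrite -subr_ge0 le_eqVlt; apply/orP; left; apply/eqP; field.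
Qed.

(* Chernoff bound: when |~: J| <= |J|, the term of index J is at most itself
   times u ^ (|J| - |~: J|), as u >= 1, and the sum over all J then factors. *)
Lemma majority_weight_le (R : realType) (I : finType) (p : I -> R) (s : R) :
  0 <= s < 2^-1 -> (forall i, 0 <= p i <= 2^-1 - s) ->
  \sum_(J : {set I} | (#|I| <= #|J|.*2)%N)
     \prod_i (if i \in J then p i else 1 - p i)
  <= expR (- (2 * s ^+ 2)) ^+ #|I|.
Proof.
move=> hs hp.
set u := Num.sqrt ((2^-1 + s) / (2^-1 - s)).
have u1 : 1 <= u.
  rewrite -(@ler_pXn2r _ 2)// ?nnegrE ?sqrtr_ge0//.
  by rewrite sqr_sqrtr ?divr_ge0 ?expr1n ?ler_pdivlMr//; lra.
have u0 : 0 < u by lra.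
have q0 i : 0 <= 1 - p i by have := hp i; lra.
apply: (@le_trans _ _ (\prod_(i : I) (p i * u + (1 - p i) / u))); last first.
  rewrite -prodr_const; apply: ler_prod => i _.
  have /andP[p0 p1] := hp i.
  by rewrite tilted_mean_le// andbT addr_ge0// ?mulr_ge0 ?invr_ge0// ltW.
(* Choosing one summand in each factor amounts to choosing a set [J], so the product becomes a sum
   over all [J]. Sets that are not a majority contribute 0 on the left and a nonnegative term on the
   right. *)
rewrite bigA_distr/= big_mkcond/= big_mkcond/=.
apply: ler_sum => J _.
have T0 : 0 <= \prod_i (if i \in J then p i else 1 - p i).
  by apply: prodr_ge0 => i _; case: ifP => _ //; have /andP[] := hp i.
have -> : \prod_i (if i \in J then p i * u else (1 - p i) / u) =
    (\prod_i (if i \in J then p i else 1 - p i)) *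
    (u ^+ #|J| / u ^+ #|~: J|).
  rewrite -[u ^+ #|J|]prodr_const -[u ^+ #|~: J|]prodr_const -prodfV.
  rewrite (big_mkcond (mem J))/= (big_mkcond (mem (~: J)))/= -!big_split/=.
  apply: eq_bigr => i _; rewrite inE.
  by case: ifP => _; rewrite /= ?mulr1 ?mul1r.
have uu : 0 < u ^+ #|J| / u ^+ #|~: J| by rewrite divr_gt0// exprn_gt0.
case: ifP => hJ; last by rewrite mulr_ge0// ltW.
rewrite ler_peMr// ler_pdivlMr ?exprn_gt0// mul1r ler_weXn2l//.
by rewrite -(leq_add2l #|J|) cardsC addnn.
Qed.

(** * Patterns: the random set of indices of the events that occur *)

Lemma pattern_fiberE (T : Type) (I : finType) (A : I -> set T) (J : {set I}) :
  [set w | [set i | `[< A i w >]]%SET = J] =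
  \bigcap_(i in [set` [set: I]%SET]) (if i \in J then A i else ~` A i).
Proof.
apply/seteqP; split => [w /= <- i _|w AJ].
  by rewrite inE; case: ifP => [/asboolP//|/negbT/asboolPn].
apply/setP => i; rewrite inE; have /= := AJ i; rewrite inE => /(_ isT).
by case: ifP => _ h; [exact/asboolP|apply/asboolPn].
Qed.

Lemma measurable_pattern_fiber d (T : measurableType d) (I : finType)
    (A : I -> set T) (J : {set I}) :
  (forall i, measurable (A i)) ->
  measurable [set w | [set i | `[< A i w >]]%SET = J].
Proof.
move=> mA; rewrite pattern_fiberE; apply: fin_bigcap_measurable => // i _.
by case: ifP => _ //; exact: measurableC.
Qed.

(** A finite union of fibres. This serves both the majority events and the measurability of order
    statistics. *)
Lemma measurable_pattern d (T : measurableType d) (I : finType)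
    (A : I -> set T) (Q : pred {set I}) :
  (forall i, measurable (A i)) ->
  measurable [set w | Q [set i | `[< A i w >]]%SET].
Proof.
move=> mA.
rewrite (_ : mkset _ = \bigcup_(J in [set` Q])
    [set w | [set i | `[< A i w >]]%SET = J]); last first.
  apply/seteqP; split => [w Qw|w [J QJ AJ]]; last by rewrite /= AJ.
  by exists [set i | `[< A i w >]]%SET.
by apply: fin_bigcup_measurable => // J _; exact: measurable_pattern_fiber.
Qed.

Lemma independent_majority_le (R : realType) d d' (T : measurableType d)
    (T' : measurableType d') (P : probability T R) (I : finType)
    (W : I -> T -> T') (B : set T') (s : R) :
  (forall i, measurable_fun setT (W i)) -> measurable B ->
  mutually_independent P W -> 0 <= s < 2^-1 ->
  (forall i, P (W i @^-1` B) <= (2^-1 - s)%:E)%E ->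
  (P [set w | (#|I| <= #|[set i | `[< B (W i w) >]]%SET|.*2)%N] <=
   (expR (- (2 * s ^+ 2)) ^+ #|I|)%:E)%E.
Proof.
move=> mW mB ind hs hP.
pose Q := [pred J : {set I} | (#|I| <= #|J|.*2)%N].
have mWB i : measurable (W i @^-1` B).
  by rewrite -[X in measurable X]setTI; exact: mW.
pose p i := fine (P (W i @^-1` B)).
have pE i : P (W i @^-1` B) = (p i)%:E by rewrite fineK// fin_num_measure.
have hp i : 0 <= p i <= 2^-1 - s.
  by have := hP i; rewrite pE lee_fin => ->; rewrite fine_ge0.
apply: (@le_trans _ _ (\sum_(J : {set I} | (#|I| <= #|J|.*2)%N)
     \prod_i (if i \in J then p i else 1 - p i))%:E); last first.
  by rewrite lee_fin majority_weight_le.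
have mG (J : {set I}) := measurable_pattern_fiber J mWB.
(* Only an upper bound is sought, so subadditivity over the fibres of the majority patterns
   suffices. *)
have sub := @content_sub_fsum _ _ _ P _ [set` Q]
  [set w | Q [set i | `[< (W i @^-1` B) w >]]%SET] _ _ (fun J _ => mG J)
  (measurable_pattern Q mWB).
apply: le_trans (sub _ _) _ => //.
  by move=> w Qw; exists [set i | `[< (W i @^-1` B) w >]]%SET.
rewrite -(@bigfs _ _ _ _ (index_enum _)) ?index_enum_uniq//; last first.
  by move=> J _; rewrite mem_index_enum.
rewrite -sumEFin le_eqVlt; apply/orP; left; apply/eqP; apply: eq_bigr => J _.
(* Independence is applied to the full index set with [B] or its complement at each index, which
   yields the product weight of the pattern [J]. *)
pose C i := if i \in J then B else ~` B.
rewrite pattern_fiberE.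
rewrite (_ : bigcap _ _ =
    \bigcap_(i in [set` [set: I]%SET]) (W i @^-1` C i)); last first.
  by apply: eq_bigcapr => i _; rewrite /C; case: ifP.
have mC i : measurable (C i).
  by rewrite /C; case: ifP => _ //; exact: measurableC.
apply: etrans (ind _ C mC) _.
have PC i : P (W i @^-1` C i) = (if i \in J then p i else 1 - p i)%:E.
  rewrite /C; case: ifP => _; first exact: pE.
  rewrite (_ : W i @^-1` _ = ~` (W i @^-1` B))//.
  by rewrite probability_setC ?pE//; exact: mWB.
rewrite -prodEFin (eq_bigl xpredT); last by move=> i; rewrite inE.
by apply: eq_bigr => i _; rewrite PC.
Qed.

(** * Order statistics and the empirical median, through counting *)

Section order_statistics.
Context (R : realType) (n : nat).
Implicit Types (x : 'I_n -> R) (q c : R) (k : nat).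

Let order_stat x k : R := (sort <=%R [seq x i | i <- enum 'I_n])`_k.

Lemma count_values x (a : pred R) :
  count a (sort <=%R [seq x i | i <- enum 'I_n]) = #|[set i | a (x i)]%SET|.
Proof.
rewrite count_sort count_map cardsE cardE /enum_mem size_filter.
by rewrite /= count_filter; apply: eq_count => i; rewrite !inE andbT.
Qed.

Lemma size_values x : size (sort <=%R [seq x i | i <- enum 'I_n]) = n.
Proof. by rewrite size_sort size_map size_enum_ord. Qed.

(** In the sorted list the values at most [c] form an initial segment, and 0-based rank [k] lies in
    it when its length exceeds [k]. The bound [k < n] keeps the default value of [nth] out. *)
Lemma order_stat_le x k c : (k < n)%N ->
  (order_stat x k <= c) = (k < #|[set i | (x i <= c)%R]%SET|)%N.
Proof.
move=> kn; rewrite -(count_values x (fun y => y <= c)).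
have so := sort_le_sorted [seq x i | i <- enum 'I_n].
apply/idP/idP; last exact: nth_count_le.
apply: contraTT; rewrite -leqNgt -ltNge => ck.
by apply: nth_count_gt => //; rewrite ck size_values.
Qed.

Lemma order_stat_ge x k c : (k < n)%N ->
  (#|[set i | (x i < c)%R]%SET| <= k)%N -> c <= order_stat x k.
Proof.
move=> kn; rewrite -(count_values x (fun y => y < c)) => ck.
by apply: nth_count_ge; [exact: sort_le_sorted|rewrite ck size_values].
Qed.

Lemma empirical_median_le x q :
  (#|[set i | (q < x i)%R]%SET|.*2 < n)%N -> empirical_median x <= q.
Proof.
move=> h.
have c : (#|[set i | (x i <= q)%R]%SET| + #|[set i | (q < x i)%R]%SET| = n)%N.
  rewrite -[RHS]card_ord -(cardsC [set i | (x i <= q)%R]%SET).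
  congr (_ + #|pred_of_set _|)%N.
  by apply/setP => i; rewrite !inE ltNge.
(* By [h], [n] is positive and at least [n./2 + 1] values are at most [q], which covers both middle
   ranks; for [n = 1] the predecessor truncates to rank 0. *)
have a1 : order_stat x n./2 <= q by rewrite order_stat_le; lia.
have a2 : order_stat x n./2.-1 <= q by rewrite order_stat_le; lia.
rewrite /empirical_median; case: ifP => _ //.
by move: a1 a2; rewrite /order_stat => a1 a2; lra.
Qed.

Lemma empirical_median_ge x q :
  (#|[set i | (x i < q)%R]%SET|.*2 < n)%N -> q <= empirical_median x.
Proof.
move=> h.
have a1 : q <= order_stat x n./2 by apply: order_stat_ge; lia.
rewrite /empirical_median; case: ifP => n2 //.
(* This needs [n] even: for odd [n], up to [n./2] values may lie below [q], so rank [n./2.-1] may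
   too. *)
have a2 : q <= order_stat x n./2.-1 by apply: order_stat_ge; lia.
by move: a1 a2; rewrite /order_stat => a1 a2; lra.
Qed.

Lemma measurable_empirical_median d (T : measurableType d)
    (X : 'I_n -> T -> R) :
  (0 < n)%N -> (forall i, measurable_fun setT (X i)) ->
  measurable_fun setT (fun w => empirical_median (X ^~ w)).
Proof.
move=> n0 mX.
have mk k : (k < n)%N -> measurable_fun setT (fun w => order_stat (X ^~ w) k).
  (* It is enough to test open upper rays. The complement of such a preimage says that more than [k]
     of the events [X i <= c] occur, a condition on their pattern. *)
  move=> kn mD; apply: (measurability _ (RGenOInfty.measurableE R)) => //.
  move=> /= _ [_ [c ->] <-]; rewrite setTI -[X in measurable X]setCK.
  apply: measurableC.
  have mA i : measurable (X i @^-1` `]-oo, c]).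
    by rewrite -[X in measurable X]setTI; exact: mX.
  have := measurable_pattern [pred J : {set _} | (k < #|J|)%N] mA.
  congr (measurable _); apply/seteqP; split => w /=;
    rewrite in_itv/= andbT => h.
  - apply/negP; rewrite -leNgt order_stat_le//.
    move: h; congr (is_true (_ < _)%N); congr #|pred_of_set _|.
    by apply/setP => i; rewrite 2!inE asboolb ?in_itv.
  - move/negP : h; rewrite -leNgt order_stat_le//.
    congr (is_true (_ < _)%N); congr #|pred_of_set _|.
    by apply/setP => i; rewrite 2!inE asboolb ?in_itv.
rewrite /empirical_median; case: (boolP (odd n)) => n2; first by apply: mk; lia.
apply: measurable_funM => //; apply: measurable_funD; apply: mk; lia.
Qed.

End order_statistics.

(** * Mass strictly beyond a quantile *)

Section quantile_tails.
Context (R : realType) (F : probability R R).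

(** As a random variable under [F], the identity has cdf [law_cdf F], so the general facts on cdfs
    apply to [F]. *)
Let idRV : R -> R := idfun.
#[local] HB.instance Definition _ :=
  @isMeasurableFun.Build _ _ _ _ idRV (@measurable_id _ _ setT).

Lemma law_cdf_nondecreasing : {homo law_cdf F : x y / x <= y >-> (x <= y)%E}.
Proof. by move=> x y; exact: (@cdf_nondecreasing _ _ _ F idRV). Qed.

(** The cdf is at least [p] at every point to the right of the quantile, hence at the quantile by
    right continuity. The limit 1 at infinity makes the infimum one of a nonempty set. *)
Lemma quantileR_tail (p : R) : p < 1 ->
  (F `]quantileR F p, +oo[%classic <= (1 - p)%:E)%E.
Proof.
move=> p1; set q := quantileR F p.
have [x px] : exists x, (p%:E < law_cdf F x)%E.
  apply: contrapT => /forallNP F_le.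
  suff : (1 <= p%:E)%E by rewrite lee_fin leNgt p1.
  apply: (cvge_to_le (@cvg_cdfy1 _ _ _ F idRV)); apply: nearW => x.
  by rewrite leNgt; exact/negP/F_le.
have pq : (p%:E <= law_cdf F q)%E.
  apply: (cvge_to_ge (@cdf_right_continuous _ _ _ F idRV q)).
  near=> y.
  have qy : q < y by near: y; exact: nbhs_right_gt.
  have [|z /= pz zy] := @inf_lt _ [set x : R | (p%:E < law_cdf F x)%E] _ _ qy.
    by exists x.
  by rewrite (le_trans (ltW pz))// law_cdf_nondecreasing// ltW.
rewrite -setCitvl probability_setC//.
by rewrite EFinB leeB.
Unshelve. all: by end_near. Qed.

(** The cdf is at most [p] at every point to the left of the quantile; continuity of [F] from below
    along closed half-lines passes this to the open one. The limit 0 at minus infinity bounds the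
    set below. *)
Lemma quantileL_tail (p : R) : 0 < p ->
  (F `]-oo, quantileL F p[%classic <= p%:E)%E.
Proof.
move=> p0; set q := quantileL F p.
have [x xp] : exists x, (law_cdf F x < p%:E)%E.
  apply: contrapT => /forallNP F_ge.
  suff : (p%:E <= 0)%E by rewrite lee_fin leNgt p0.
  apply: (cvge_to_ge (@cvg_cdfNy0 _ _ _ F idRV)); apply: nearW => x.
  by rewrite leNgt; exact/negP/F_ge.
have lb : has_lbound [set x : R | (p%:E <= law_cdf F x)%E].
  exists x => y /= py; rewrite leNgt; apply/negP => /ltW/law_cdf_nondecreasing.
  by move=> /(le_trans py); rewrite leNgt xp.
have lt_q y : y < q -> (law_cdf F y <= p%:E)%E.
  move=> yq; rewrite leNgt; apply/negP => /ltW py.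
  by have := ge_inf lb py; rewrite leNgt yq.
have -> : `]-oo, q[%classic = \bigcup_k `]-oo, q - k.+1%:R^-1]%classic.
  apply/seteqP; split => [y|y [k _]]; rewrite /= !in_itv/=.
    move=> /ltr_add_invr[k yk]; exists k => //=.
    by rewrite in_itv/= lerBrDr ltW.
  by move=> /le_lt_trans; apply; rewrite ltrBlDr ltrDl.
apply: (@cvge_to_le _ _ _ _ _ _ _ (nondecreasing_cvg_mu _ _ _)) => //.
- by apply: bigcup_measurable.
- move=> m k mk; apply/subsetPset; apply: subset_itvl.
  by rewrite bnd_simp lerD2l lerN2 lef_pV2 ?posrE// ler_nat.
- by apply: nearW => k /=; apply: lt_q; rewrite ltrBlDr ltrDl.
Qed.

End quantile_tails.

(** * Contaminated samples and the final bound *)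

Lemma contaminated_majority_le (R : realType) (eps s : R) (F : probability R R)
    (n : nat) d (T : measurableType d) (P : probability T R)
    (Y : 'I_n -> {RV P >-> R}) (D : 'I_n -> {RV P >-> bool}) (A : set R) :
  (forall i B, measurable B -> distribution P (Y i) B = F B) ->
  0 <= eps <= 1 ->
  (forall i B, distribution P (D i) B = bernoulli_prob eps B) ->
  mutually_independent P (fun i w => (Y i w, D i w)) ->
  measurable A -> 0 <= s < 2^-1 -> (F A <= (2^-1 - (eps + s))%:E)%E ->
  let E := [set w | (n <= #|[set i | `[< A (Y i w) \/ D i w >]]%SET|.*2)%N] in
  measurable E /\ (P E <= (expR (- (2 * s ^+ 2)) ^+ n)%:E)%E.
Proof.
move=> hY eps01 hD ind mA hs FA E.
(* Independence holds across pairs only, so each event is expressed as the preimage of a single set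
   of pairs. *)
pose B := [set yb : R * bool | A yb.1 \/ yb.2].
have BE : B = (fst @^-1` A) `|` (snd @^-1` [set true]) by [].
have mB : measurable B.
  rewrite BE; apply: measurableU; rewrite -[X in measurable X]setTI.
    exact: measurable_fst.
  exact: measurable_snd.
have mY i : measurable (Y i @^-1` A) by exact: measurable_funPTI.
have mD i : measurable (D i @^-1` [set true]) by exact: measurable_funPTI.
have mW i : measurable_fun setT (fun w => (Y i w, D i w)).
  exact: measurable_fun_pair.
have mWB i : measurable ((fun w => (Y i w, D i w)) @^-1` B).
  by rewrite -[X in measurable X]setTI; exact: mW.
have PB i : (P ((fun w => (Y i w, D i w)) @^-1` B) <= (2^-1 - s)%:E)%E.
  rewrite (_ : _ @^-1` B = (Y i @^-1` A) `|` (D i @^-1` [set true]))//.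
  (* The union bound copes with any dependence between [Y i] and [D i], at the cost of adding
     [eps]. *)
  apply: (le_trans (measureU2 _ _ _)) => //.
  have -> : (2^-1 - s)%:E = ((2^-1 - (eps + s))%:E + eps%:E)%E.
    by rewrite -EFinD; congr EFin; ring.
  apply: leeD; first by rewrite -(hY i A mA) in FA.
  rewrite [X in (X <= _)%E](hD i [set true]) bernoulli_probE//.
  by rewrite !diracE mem_set// memNset//= mule1 mule0 adde0.
split; last first.
  by have := independent_majority_le mW mB ind hs PB; rewrite card_ord.
exact: (measurable_pattern [pred J : {set _} | (n <= #|J|.*2)%N] mWB).
Qed.

Theorem lemma7 (R : realType) (tbar eps : R)
    (htbar : 0 < tbar < 2^-1) (heps : 0 < eps < tbar)
    (r : R -> R)
    (r_ge0 : forall t, t \in `[0, tbar] -> 0 <= r t)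
    (r_mono : {in `[0, tbar] &, {homo r : s t / s <= t}})
    (F : probability R R)
    (hF : quantile_family tbar r F)
    (n : nat) (d : measure_display) (T : measurableType d)
    (P : probability T R)
    (Y : 'I_n -> {RV P >-> R})
    (D : 'I_n -> {RV P >-> bool})
    (hY : forall i A, measurable A -> distribution P (Y i) A = F A)
    (hD : forall i A, distribution P (D i) A = bernoulli_prob eps A)
    (hind : mutually_independent P (fun i w => (Y i w, D i w)))
    (Z : 'I_n -> {RV P >-> R}) (X : 'I_n -> T -> R)
    (hX : forall i w,
      X i w = (1 - (D i w)%:R) * Y i w + (D i w)%:R * Z i w)
    (delta : R) (hdelta : 0 < delta < 1)
    (hn : 2 * (tbar - eps) ^- 2 * ln (3 / delta) <= n%:R) :
  ((1 - delta)%:E <=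
   P [set w | ereal_sup
        [set `|empirical_median (X ^~ w) - m|%:E | m in medians F]
      <= (r (eps + Num.sqrt (2 * ln (3 / delta) / n%:R)))%:E])%E.
Proof.
have L0 : 0 < ln (3 / delta).
  rewrite ln_gt0// ltr_pdivlMr; lra.
have n0 : (0 < n)%N.
  rewrite -(ltr_nat R); apply: lt_le_trans hn.
  by rewrite !mulr_gt0// invr_gt0 exprn_gt0//; lra.
have n0R : 0 < n%:R :> R by rewrite ltr0n.
set s := Num.sqrt (2 * ln (3 / delta) / n%:R).
set t := eps + s.
have s0 : 0 <= s by exact: sqrtr_ge0.
have s2 : s ^+ 2 = 2 * ln (3 / delta) / n%:R.
  by rewrite sqr_sqrtr// !mulr_ge0// ?invr_ge0 ltW.
(* Once squared, this is the sample size hypothesis [hn]; it puts [t] in the range where [hF]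
   applies. *)
have st : s <= tbar - eps.
  have te : 0 < tbar - eps by lra.
  rewrite -(@ler_pXn2r _ 2)// ?nnegrE ?(ltW te)// s2 ler_pdivrMr//.
  by rewrite -ler_pdivrMl ?exprn_gt0// mulrCA mulrA.
have hs : 0 <= s < 2^-1 by lra.
have ht : t \in `[0, tbar] by rewrite in_itv/= /t; lra.
set qR := quantileR F (2^-1 + t); set qL := quantileL F (2^-1 - t).
have FR : (F `]qR, +oo[%classic <= (2^-1 - (eps + s))%:E)%E.
  have -> : 2^-1 - (eps + s) = 1 - (2^-1 + t) by rewrite /t; lra.
  by apply: quantileR_tail; rewrite /t; lra.
have FL : (F `]-oo, qL[%classic <= (2^-1 - (eps + s))%:E)%E.
  by apply: quantileL_tail; rewrite /t; lra.
have eps01 : 0 <= eps <= 1 by lra.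
have [mBR PBR] :=
  contaminated_majority_le hY eps01 hD hind (measurable_itv _) hs FR.
have [mBL PBL] :=
  contaminated_majority_le hY eps01 hD hind (measurable_itv _) hs FL.
move: mBR PBR mBL PBL; set BR := [set w | _]; set BL := [set w | _].
move=> mBR PBR mBL PBL.
have XE i : X i = fun w => if D i w then Z i w else Y i w.
  apply/funext => w; rewrite hX.
  by case: (D i w); rewrite ?subrr ?subr0 ?mul0r ?mul1r ?add0r ?addr0.
have mX i : measurable_fun setT (X i).
  by rewrite XE; exact: measurable_fun_ifT.
have mmed := measurable_empirical_median n0 mX.
set E := [set w | _].
(* There may be uncountably many medians, but an intersection of closed intervals is closed, hence
   measurable whatever their number. *)
have EE : E = (fun w => empirical_median (X ^~ w)) @^-1`
    (\bigcap_(m in medians F) `[m - r t, m + r t]%classic).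
  apply/seteqP; split => w /=.
    move=> /ereal_supP Ew m Fm /=; rewrite in_itv/= -ler_distl -lee_fin.
    by apply: Ew; exists m.
  move=> Ew; apply/ereal_supP => _ [m Fm <-].
  by rewrite lee_fin ler_distl; have := Ew m Fm; rewrite /= in_itv.
have mE : measurable E.
  rewrite EE -[X in measurable X]setTI; apply: mmed => //.
  by apply: closed_measurable; apply: closed_bigI => m _;
    exact: interval_closed.
(* Outside both bad events the empirical median lies between [qL] and [qR], and [hF] places both
   within [r t] of every median. *)
have sub : ~` E `<=` BR `|` BL.
  move=> w nEw; apply: contrapT => /not_orP[nR nL]; apply: nEw.
  rewrite EE => m Fm /=.
  have := hF t ht m Fm; rewrite ge_max -/qR -/qL => /andP[rR rL].
  have lR : empirical_median (X ^~ w) <= qR.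
    apply: empirical_median_le; rewrite ltnNge; apply/negP => h; apply: nR.
    apply: leq_trans h _; rewrite leq_double.
    apply/subset_leq_card/fintype.subsetP.
    move=> i; rewrite !inE XE => h; rewrite /= in_itv/= andbT.
    by case: (D i w) h => h; [right|left; rewrite h].
  have lL : qL <= empirical_median (X ^~ w).
    apply: empirical_median_ge; rewrite ltnNge; apply/negP => h; apply: nL.
    apply: leq_trans h _; rewrite leq_double.
    apply/subset_leq_card/fintype.subsetP.
    move=> i; rewrite !inE XE => h; rewrite /= in_itv/=.
    by case: (D i w) h => h; [right|left; rewrite h].
  by rewrite in_itv/=; lra.
have PE : (P (~` E) <= delta%:E)%E.
  apply: (le_trans (le_measure P _ _ sub)); rewrite ?inE//.
  - exact: measurableC.
  - exact: measurableU.
  apply: (le_trans (measureU2 _ _ _)) => //.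
  apply: (le_trans (leeD PBR PBL)).
  rewrite -EFinD lee_fin -expRM_natr s2.
  (* Each bad event has probability at most (delta / 3)^4 <= delta / 3, so the two together stay
     below [delta]. *)
  have -> : - (2 * (2 * ln (3 / delta) / n%:R)) * n%:R = - (4 * ln (3 / delta)).
    by field; rewrite gt_eqF.
  have : expR (- (4 * ln (3 / delta))) <= delta / 3.
    rewrite -[leRHS]invf_div -[leRHS]lnK ?posrE ?invr_gt0 ?divr_gt0//; last lra.
    rewrite ler_expR lnV ?posrE ?divr_gt0//; lra.
  by lra.
move: PE; rewrite probability_setC//.
have -> : P E = (fine (P E))%:E by rewrite fineK// fin_num_measure.
by rewrite -EFinB !lee_fin; lra.
Qed.
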